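(* For all finite sets of formulas $\Psi,\Phi$: if $\mathbf{D}^3_{\rm seq}\vdash \Psi\Rightarrow_{\mathsf D}\Phi$, then the D-sequent $\Psi\Rightarrow_{\mathsf D}\Phi$ is provable in $\mathbf{D}^3_{\rm seq}$ without using any cut rule.
   Context: Formulas are built from propositional variables and $\bot$ by $\to$ and $\Box$. $\Gamma,\Delta,\Pi,\Sigma,\ldots$ denote finite sets of formulas; commas denote union (and $\varphi$ stands for $\{\varphi\}$); $\Box\Gamma=\{\Box\gamma\mid\gamma\in\Gamma\}$. There are three kinds of sequents (tagged pairs of finite sets of formulas): GL-sequents $\Gamma\Rightarrow\Delta$, S-sequents $\Gamma\Rightarrow_{\mathsf S}\Delta$, D-sequents $\Gamma\Rightarrow_{\mathsf D}\Delta$. For each arrow $\blacktriangleright\in\{\Rightarrow,\Rightarrow_{\mathsf S},\Rightarrow_{\mathsf D}\}$, $\mathbf{LK}_{\blacktriangleright}$ has initial sequents $\varphi\blacktriangleright\varphi$ and $\bot\blacktriangleright\ $ (empty right side) and the rules: (weakening) from $\Gamma\blacktriangleright\Delta$ infer $\Gamma'\blacktriangleright\Delta'$, where $\Gamma\subseteq\Gamma'$, $\Delta\subseteq\Delta'$; ($\to$left) from $\Gamma\blacktriangleright\Delta,\varphi$ and $\psi,\Gamma\blacktriangleright\Delta$ infer $\varphi\to\psi,\Gamma\blacktriangleright\Delta$; ($\to$right) from $\varphi,\Gamma\blacktriangleright\Delta,\psi$ infer $\Gamma\blacktriangleright\Delta,\varphi\to\psi$; (cut) from $\Gamma\blacktriangleright\Delta,\varphi$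 and $\varphi,\Pi\blacktriangleright\Sigma$ infer $\Gamma,\Pi\blacktriangleright\Delta,\Sigma$. Further rules: (GL$\Box$) from $\Gamma,\Box\Gamma,\Box\varphi\Rightarrow\varphi$ infer $\Box\Gamma\Rightarrow\Box\varphi$; (GLtoS) from $\Gamma\Rightarrow\Delta$ infer $\Gamma\Rightarrow_{\mathsf S}\Delta$; (S$\Box$left) from $\varphi,\Gamma\Rightarrow_{\mathsf S}\Delta$ infer $\Box\varphi,\Gamma\Rightarrow_{\mathsf S}\Delta$; (StoD) from $\Box\Gamma\Rightarrow_{\mathsf S}\Box\Delta$ infer $\Box\Gamma\Rightarrow_{\mathsf D}\Box\Delta$. $\mathbf{D}^3_{\rm seq}$ consists of $\mathbf{LK}_{\Rightarrow}$, $\mathbf{LK}_{\Rightarrow_{\mathsf S}}$, $\mathbf{LK}_{\Rightarrow_{\mathsf D}}$, (GL$\Box$), (GLtoS), (S$\Box$left), (StoD). Cut-free provability means provability without the cut rules for any of the three kinds of sequents. *)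

(* Defs.v *)
From HB Require Import structures.
From mathcomp Require Import all_boot finmap.

Set Implicit Arguments.
Unset Strict Implicit.
Unset Printing Implicit Defensive.

Local Open Scope fset_scope.

Inductive formula : Type :=
| Var of nat
| Bot
| Imp of formula & formula
| Box of formula.

(* Encoding into generic trees: equips [formula] with the choice structure
   that finmap requires of the elements of a finite set. *)
Fixpoint formula_encode (f : formula) : GenTree.tree nat :=
  match f with
  | Var n => GenTree.Leaf n
  | Bot => GenTree.Node 0 [::]
  | Imp f g => GenTree.Node 1 [:: formula_encode f; formula_encode g]
  | Box f => GenTree.Node 2 [:: formula_encode f]
  end.

Fixpoint formula_decode (t : GenTree.tree nat) : formula :=
  match t with
  | GenTree.Leaf n => Var n
  | GenTree.Node 1 [:: t; u] => Imp (formula_decode t) (formula_decode u)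
  | GenTree.Node 2 [:: t] => Box (formula_decode t)
  | _ => Bot
  end.

Lemma formula_encodeK : cancel formula_encode formula_decode.
Proof. by elim=> //= [f -> g ->|f ->]. Qed.

HB.instance Definition _ := Countable.copy formula (can_type formula_encodeK).

Definition boxset (G : {fset formula}) : {fset formula} :=
  [fset Box g | g in G].

Inductive arrow : Set := ArrGL | ArrS | ArrD.

Record sequent : Type := Sequent {
  seq_arrow : arrow;
  antecedent : {fset formula};
  succedent : {fset formula}
}.

Notation "G ▷[ a ] D" := (Sequent a G D)
  (at level 70, a at level 200, D at level 69, format "G  ▷[ a ]  D").
Notation "G ⇒ D" := (Sequent ArrGL G D) (at level 70, D at level 69).
Notation "G '⇒S' D" := (Sequent ArrS G D) (at level 70, D at level 69).
Notation "G '⇒D' D" := (Sequent ArrD G D) (at level 70, D at level 69).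

(* [D3seq with_cut s]: the sequent [s] is provable in D^3_seq, where the three
   cut rules are available exactly when [with_cut] is [true].  As the comma
   denotes union, the principal and side formulas of a rule may already belong
   to its context. *)
Inductive D3seq (with_cut : bool) : sequent -> Prop :=
| D3_ax a phi :
    D3seq with_cut ([fset phi] ▷[a] [fset phi])
| D3_bot a :
    D3seq with_cut ([fset Bot] ▷[a] fset0)
| D3_weakening a G D G' D' :
    G `<=` G' -> D `<=` D' ->
    D3seq with_cut (G ▷[a] D) ->
    D3seq with_cut (G' ▷[a] D')
| D3_imp_left a G D phi psi :
    D3seq with_cut (G ▷[a] D `|` [fset phi]) ->
    D3seq with_cut (psi |` G ▷[a] D) ->
    D3seq with_cut (Imp phi psi |` G ▷[a] D)
| D3_imp_right a G D phi psi :
    D3seq with_cut (phi |` G ▷[a] D `|` [fset psi]) ->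
    D3seq with_cut (G ▷[a] D `|` [fset Imp phi psi])
| D3_cut a G D P S phi :
    with_cut ->
    D3seq with_cut (G ▷[a] D `|` [fset phi]) ->
    D3seq with_cut (phi |` P ▷[a] S) ->
    D3seq with_cut (G `|` P ▷[a] D `|` S)
| D3_GLbox G phi :
    D3seq with_cut (G `|` boxset G `|` [fset Box phi] ⇒ [fset phi]) ->
    D3seq with_cut (boxset G ⇒ [fset Box phi])
| D3_GLtoS G D :
    D3seq with_cut (G ⇒ D) ->
    D3seq with_cut (G ⇒S D)
| D3_Sbox_left G D phi :
    D3seq with_cut (phi |` G ⇒S D) ->
    D3seq with_cut (Box phi |` G ⇒S D)
| D3_StoD G D :
    D3seq with_cut (boxset G ⇒S boxset D) ->
    D3seq with_cut (boxset G ⇒D boxset D).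

Definition provable : sequent -> Prop := D3seq true.
Definition cut_free_provable : sequent -> Prop := D3seq false.

(* Main.v *)
(** Cut-free completeness for a class of Kripke models in which the system
    with cut is sound.  GL-sequents are read at every point of a transitive
    conversely well-founded model, S-sequents at a distinguished point where
    reflection holds, and D-sequents at a point with the same successors as the
    S-point but its own valuation.  From a D-sequent without cut-free proof one
    obtains a countermodel: maximal unprovable GL-sequents form its upper part,
    below them hangs an infinite descending chain of copies of one maximal
    unprovable S-sequent, and the S- and D-points sit below the whole chain.
    Truth values stabilise along the chain, which gives reflection. *)
From Stdlib Require Import Classical.
Require Import Defs.
From mathcomp Require Import all_boot finmap.

Set Implicit Arguments.
Unset Strict Implicit.
Unset Printing Implicit Defensive.

Local Open Scope fset_scope.

(** * Kripke semantics and soundness with cut *)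

Fixpoint force (W : Type) (R : W -> W -> Prop) (V : W -> nat -> Prop)
    (w : W) (f : formula) : Prop :=
  match f with
  | Var p => V w p
  | Bot => False
  | Imp f g => force R V w f -> force R V w g
  | Box f => forall v, R w v -> force R V v f
  end.

Definition sat (W : Type) (R : W -> W -> Prop) (V : W -> nat -> Prop)
    (w : W) (G D : {fset formula}) : Prop :=
  (forall f, f \in G -> force R V w f) ->
  exists2 f, f \in D & force R V w f.

Definition point (W : Type) (s d : W) (a : arrow) (w : W) : Prop :=
  match a with ArrGL => True | ArrS => w = s | ArrD => w = d end.

Lemma boxsetP (G : {fset formula}) (f : formula) :
  reflect (exists2 g, g \in G & f = Box g) (f \in boxset G).
Proof. exact: imfsetP. Qed.

(** By induction on the derivation. Converse well-foundedness and transitivity validate the GL box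
    rule, reflection at [s] validates the left box rule for S, and the step from S to D holds
    because [s] and [d] have the same successors, hence agree on boxed formulas. *)
Lemma soundness (W : Type) (R : W -> W -> Prop) (V : W -> nat -> Prop)
    (s d : W) :
  (forall u v w, R u v -> R v w -> R u w) ->
  well_founded (fun v w => R w v) ->
  (forall f, force R V s (Box f) -> force R V s f) ->
  (forall v, R d v <-> R s v) ->
  forall q, provable q ->
  forall w, point s d (seq_arrow q) w ->
  sat R V w (antecedent q) (succedent q).
Proof.
move=> Rtrans Rwf refl_s Rds q; elim=> {q}
  [a f|a|a G D G' D' sG sD _ IH|a G D f g _ IH1 _ IH2|a G D f g _ IH
  |a G D P S f _ _ IH1 _ IH2|G f _ IH|G D _ IH|G D f _ IH|G D _ IH] w /= pw hG.
- by exists f; rewrite ?inE //; apply: hG; rewrite inE.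
- by case: (hG Bot); rewrite inE.
- case: (IH w pw) => [f fG|f fD hf]; first by apply: hG; apply: (fsubsetP sG).
  by exists f => //; apply: (fsubsetP sD).
- have hG' h : h \in G -> force R V w h.
    by move=> hin; apply: hG; rewrite !inE hin orbT.
  have hfg : force R V w (Imp f g) by apply: hG; rewrite !inE eqxx.
  case: (IH1 w pw hG') => h; rewrite !inE => /orP[hD hh|/eqP -> hf].
    by exists h.
  apply: (IH2 w pw) => h'; rewrite !inE => /orP[/eqP -> |]; last exact: hG'.
  exact: hfg.
- case: (classic (force R V w f)) => hf; last first.
    by exists (Imp f g); [rewrite !inE eqxx orbT | move=> /hf].
  case: (IH w pw) => [h|h]; rewrite !inE.
    by move=> /orP[/eqP -> //|]; exact: hG.
  move=> /orP[hD hh|/eqP -> hg]; first by exists h => //; rewrite inE hD.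
  by exists (Imp f g); [rewrite !inE eqxx orbT | move=> _].
- case: (IH1 w pw) => [h hin|h]; first by apply: hG; rewrite inE hin.
  rewrite !inE => /orP[hD hh|/eqP -> hf]; first by exists h => //; rewrite inE hD.
  case: (IH2 w pw) => [h'|h' h'S hh'].
    by rewrite !inE => /orP[/eqP -> //|hin]; apply: hG; rewrite inE hin orbT.
  by exists h' => //; rewrite inE h'S orbT.
- exists (Box f); first by rewrite inE.
  (* Löb's argument: the induction hypothesis at the successors of [v], which by transitivity are
     successors of [w], yields [Box f] at [v], as the premise of the rule demands. *)
  move=> v; elim/(well_founded_ind Rwf): v => v IHv wv.
  case: (IH v I) => [h|h]; rewrite !inE; last by move=> /eqP ->.
  have hbox g : g \in G -> forall u, R w u -> force R V u g.
    by move=> gG; apply: (hG (Box g)); apply/boxsetP; exists g.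
  move=> /orP[/orP[hin|/boxsetP[g gG ->]]|/eqP ->] /=.
  + exact: hbox hin _ wv.
  + by move=> u vu; apply: hbox gG _ (Rtrans _ _ _ wv vu).
  + by move=> u vu; apply: IHv vu (Rtrans _ _ _ wv vu).
- exact: IH.
- apply: (IH w pw) => h; rewrite !inE => /orP[/eqP ->|hin].
    by rewrite pw; apply: refl_s; rewrite -pw; apply: hG; rewrite !inE eqxx.
  by apply: hG; rewrite !inE hin orbT.
- have boxE g : force R V w (Box g) <-> force R V s (Box g).
    by rewrite pw /=; split=> h v /Rds; apply: h.
  case: (IH s erefl) => [h hin|h hin hh].
    by have := hG h hin; case/boxsetP: hin => g _ ->; rewrite boxE.
  by exists h => //; move: hh; case/boxsetP: hin => g _ ->; rewrite boxE.
Qed.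

(** * Finite sets closed under subformulas *)

Definition sub_closed (F : {fset formula}) : Prop :=
  forall f, f \in F ->
  match f with
  | Imp g h => g \in F /\ h \in F
  | Box g => g \in F
  | _ => True
  end.

Lemma sub_closedU (F F' : {fset formula}) :
  sub_closed F -> sub_closed F' -> sub_closed (F `|` F').
Proof.
move=> cF cF' f; rewrite inE => /orP[/cF|/cF']; case: f => //= [g h [hg hh]|g hg].
all: by rewrite !inE ?hg ?hh ?orbT.
Qed.

Lemma formula_sub_closure (f : formula) :
  exists2 F : {fset formula}, sub_closed F & f \in F.
Proof.
elim: f => [p||f [F cF fF] g [F' cF' gF']|f [F cF fF]].
- by exists [fset Var p]; rewrite ?inE // => h; rewrite inE => /eqP ->.
- by exists [fset Bot]; rewrite ?inE // => h; rewrite inE => /eqP ->.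
- exists (Imp f g |` (F `|` F')); last by rewrite !inE eqxx.
  move=> h; rewrite inE => /orP[|/(sub_closedU cF cF')].
    by rewrite inE => /eqP ->; rewrite !inE fF gF' !orbT.
  by case: h => //= [? ? [h1 h2]|? h1]; rewrite !in_fset1U ?h1 ?h2 ?orbT.
- exists (Box f |` F); last by rewrite !inE eqxx.
  move=> h; rewrite inE => /orP[|/cF].
    by rewrite inE => /eqP ->; rewrite !inE fF !orbT.
  by case: h => //= [? ? [h1 h2]|? h1]; rewrite !in_fset1U ?h1 ?h2 ?orbT.
Qed.

Lemma sub_closure (G : {fset formula}) :
  exists2 F : {fset formula}, sub_closed F & G `<=` F.
Proof.
elim/fset1U_rect: G => [|f G _ [F cF GF]]; first by exists fset0.
have [F' cF' fF'] := formula_sub_closure f.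
exists (F' `|` F); first exact: sub_closedU.
by apply: fsetUSS => //; rewrite fsub1set.
Qed.

(** * Maximal unprovable sequents *)

Definition maximal (F : {fset formula}) (q : sequent) : Prop :=
  let: Sequent a G D := q in
  [/\ G `<=` F, D `<=` F, ~ cut_free_provable q,
      forall f, f \in F -> f \notin G -> cut_free_provable (f |` G ▷[a] D)
    & forall f, f \in F -> f \notin D ->
        cut_free_provable (G ▷[a] D `|` [fset f])].

Lemma ltn_card_fset (A B : {fset formula}) (f : formula) :
  {subset A <= B} -> f \in B -> f \notin A -> #|` A| < #|` B|.
Proof.
move=> /fsubsetP AB fB fA; apply: fproper_ltn_card.
by rewrite fproperE AB /=; apply: contraNN fA => /fsubsetP; apply.
Qed.

(** Formulas of [F] are added to either side as long as the sequent stays unprovable; the number of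
    formulas of [F] missing on the left plus that on the right decreases each time. *)
Lemma maximal_extension (F : {fset formula}) (a : arrow)
    (G D : {fset formula}) :
  G `<=` F -> D `<=` F -> ~ cut_free_provable (G ▷[a] D) ->
  exists G' D', [/\ maximal F (G' ▷[a] D'), G `<=` G' & D `<=` D'].
Proof.
have [n] := ubnP (#|` F `\` G| + #|` F `\` D|).
have lt_diff (E : {fset formula}) (f : formula) :
    f \in F -> f \notin E -> #|` F `\` (f |` E)| < #|` F `\` E|.
  move=> fF fE; apply: (ltn_card_fset (f := f)) => [h||];
    rewrite !inE ?eqxx ?fE //.
  by rewrite negb_or -andbA => /and3P[_ -> ->].
elim: n => // n IH in G D *; rewrite ltnS => le_n GF DF nGD.
case: (classic (exists2 f, f \in F /\ f \notin G
                  & ~ cut_free_provable (f |` G ▷[a] D))) => [[f [fF fG] nf]|maxG].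
  have [||G' [D' [mx sG sD]]] := IH (f |` G) D _ _ DF nf.
  - by apply: leq_trans le_n; rewrite ltn_add2r lt_diff.
  - by rewrite fsubUset fsub1set fF.
  - by exists G', D'; split=> //; apply: fsubset_trans sG; apply: fsubsetUr.
case: (classic (exists2 f, f \in F /\ f \notin D
                  & ~ cut_free_provable (G ▷[a] D `|` [fset f])))
    => [[f [fF fD] nf]|maxD].
  have [||G' [D' [mx sG sD]]] := IH G (D `|` [fset f]) _ GF _ nf.
  - by apply: leq_trans le_n; rewrite ltn_add2l fsetUC lt_diff.
  - by rewrite fsubUset fsub1set fF DF.
  - by exists G', D'; split=> //; apply: fsubset_trans sD; apply: fsubsetUl.
exists G, D; split=> //; split=> // f fF fE; apply: NNPP => nf.
  by apply: maxG; exists f.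
by apply: maxD; exists f.
Qed.

Section MaximalSequents.

Variables (F : {fset formula}) (a : arrow) (G D : {fset formula}).
Hypothesis mx : maximal F (G ▷[a] D).

Lemma maximal_disjoint (f : formula) : f \in G -> f \in D -> False.
Proof.
case: mx => _ _ nGD _ _ fG fD; apply: nGD.
by apply: (D3_weakening _ _ (D3_ax _ a f)); rewrite fsub1set.
Qed.

Lemma maximal_bot : Bot \in G -> False.
Proof.
case: mx => _ _ nGD _ _ bG; apply: nGD.
by apply: (D3_weakening _ _ (D3_bot _ a)); rewrite ?fsub1set ?fsub0set.
Qed.

Lemma maximal_imp_left (f g : formula) :
  sub_closed F -> Imp f g \in G -> f \in D \/ g \in G.
Proof.
case: mx => GF _ nGD mG mD cF fgG.
have [fF gF] := cF _ (fsubsetP GF _ fgG).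
case: (boolP (f \in D)) => fD; first by left.
case: (boolP (g \in G)) => gG; first by right.
(* Since the comma is union, the principal formula may stay in the context, so maximality proves
   both premises. *)
case: nGD; have -> : G = Imp f g |` G by rewrite mem_fset1U.
by apply: D3_imp_left; [apply: mD | apply: mG].
Qed.

Lemma maximal_imp_right (f g : formula) :
  sub_closed F -> Imp f g \in D -> f \in G /\ g \in D.
Proof.
case: mx => GF DF nGD mG mD cF fgD.
have [fF gF] := cF _ (fsubsetP DF _ fgD).
have DE : D = D `|` [fset Imp f g] by rewrite fsetUC mem_fset1U.
apply: NNPP => nfg; apply: nGD; rewrite DE; apply: D3_imp_right.
(* If [f] lies in [G], only [g] is new in the premise, which maximality on the right proves;
   otherwise adding [f] alone gives a provable sequent, and weakening adds [g]. *)
case: (boolP (f \in G)) => fG.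
  rewrite mem_fset1U //; apply: mD => //.
  by apply/negP => gD; apply: nfg.
by apply: D3_weakening (mG f fF fG); rewrite ?fsubsetUl.
Qed.

End MaximalSequents.

Lemma maximal_reflexive (F G D : {fset formula}) (f : formula) :
  sub_closed F -> maximal F (G ⇒S D) -> Box f \in G -> f \in G.
Proof.
move=> cF [GF _ nGD mG _] bG; have fF := cF _ (fsubsetP GF _ bG).
apply/negPn/negP => fG; apply: nGD.
have -> : G = Box f |` G by rewrite mem_fset1U.
by apply: D3_Sbox_left; apply: mG.
Qed.

(** * Canonical successors for GL *)

Definition unbox (F G : {fset formula}) : {fset formula} :=
  [fset f in F | Box f \in G].

Lemma boxset_unbox (F G : {fset formula}) : boxset (unbox F G) `<=` G.
Proof. by apply/fsubsetP=> f /boxsetP[g]; rewrite !inE => /andP[_ h] ->. Qed.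

Lemma mem_boxset_unbox (F G : {fset formula}) (f : formula) :
  sub_closed F -> G `<=` F -> Box f \in G -> Box f \in boxset (unbox F G).
Proof.
move=> cF GF bG; apply/boxsetP; exists f => //.
by rewrite !inE bG andbT; apply: (cF (Box f)); apply: (fsubsetP GF).
Qed.

Definition successor (F : {fset formula}) (G : {fset formula}) (q : sequent) :
    Prop :=
  [/\ maximal F q, seq_arrow q = ArrGL
    & forall f, Box f \in G -> f \in antecedent q /\ Box f \in antecedent q].

(** The GL box rule read backwards gives an unprovable premise, and any maximal extension of it
    serves. That [Box f] enters the antecedent later makes the step to [q] strict. *)
Lemma successor_exists (F G D : {fset formula}) (f : formula) :
  sub_closed F -> G `<=` F -> D `<=` F -> ~ cut_free_provable (G ⇒ D) ->
  Box f \in D ->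
  exists q, [/\ successor F G q, Box f \in antecedent q & f \in succedent q].
Proof.
move=> cF GF DF nGD bD; have bF := fsubsetP DF _ bD; have fF := cF _ bF.
have [|||G' [D' [mx sG sD]]] := @maximal_extension F ArrGL
  (unbox F G `|` boxset (unbox F G) `|` [fset Box f]) [fset f].
- rewrite !fsubUset fsub1set bF (fsubset_trans (boxset_unbox F G) GF) !andbT.
  by apply/fsubsetP=> g; rewrite !inE => /andP[].
- by rewrite fsub1set.
- move=> pr; apply: nGD; apply: D3_weakening (D3_GLbox pr).
    exact: boxset_unbox.
  by rewrite fsub1set.
exists (G' ⇒ D'); split; [split=> // g bG | |] => /=.
- split; apply: (fsubsetP sG); rewrite !in_fsetU; last first.
    by rewrite (mem_boxset_unbox cF GF bG) orbT.
  by rewrite !inE bG (cF _ (fsubsetP GF _ bG)).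
- by apply: (fsubsetP sG); rewrite !inE eqxx orbT.
- by apply: (fsubsetP sD); rewrite inE.
Qed.

(** * The countermodel and its frame conditions *)

Inductive world : Type :=
| Canon of sequent
| Tail of nat
| Limit of sequent.

Definition label (s : sequent) (w : world) : sequent :=
  match w with Canon q => q | Tail _ => s | Limit q => q end.

(* The successors of a limit point do not depend on its label, so that the
   S-point [Limit s] and the D-point satisfy the same boxed formulas. *)
Definition accessible (F : {fset formula}) (s : sequent) (w v : world) : Prop :=
  match w, v with
  | Canon q, Canon r =>
      successor F (antecedent q) r /\
      exists2 f, Box f \in antecedent r & Box f \notin antecedent q
  | Tail _, Canon r | Limit _, Canon r => successor F (antecedent s) r
  | Tail n, Tail m => m < n
  | Limit _, Tail _ => True
  | _, _ => False
  end.

Definition val (s : sequent) (w : world) (p : nat) : Prop :=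
  Var p \in antecedent (label s w).

Lemma successor_trans (F G : {fset formula}) (q r : sequent) :
  successor F G q -> successor F (antecedent q) r -> successor F G r.
Proof.
by move=> [_ _ hq] [mr ar hr]; split=> // f /hq[_]; apply: hr.
Qed.

Lemma accessible_trans (F : {fset formula}) (s : sequent) (u v w : world) :
  accessible F s u v -> accessible F s v w -> accessible F s u w.
Proof.
case: u v w => [q|n|q] [r|m|r] [t|k|t] //=.
- move=> [qr [f fr fq]] [rt _]; split; first exact: successor_trans rt.
  by exists f => //; case: rt => _ _ /(_ _ fr)[].
- by move=> h [h' _]; apply: successor_trans h h'.
- by move=> mn km; apply: ltn_trans mn.
- by move=> h [h' _]; apply: successor_trans h h'.
Qed.

(** Each step between canonical points puts a new boxed formula of [F] into the antecedent and loses
    none; tail points see only canonical points and tails of smaller index, and no point sees a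
    limit point. *)
Lemma accessible_wf (F : {fset formula}) (s : sequent) :
  sub_closed F -> well_founded (fun v w => accessible F s w v).
Proof.
move=> cF.
have accC q : Acc (fun v w => accessible F s w v) (Canon q).
  have [n] := ubnP #|` unbox F F `\` unbox F (antecedent q)|.
  elim: n => [|n IH] in q *; first by rewrite ltn0.
  rewrite ltnS => le_n; constructor=> -[r|//|//].
  move=> /= [[mr _ hr] [f fr fq]]; apply: IH; apply: leq_trans le_n.
  have bF : Box f \in F.
    by case: r mr fr {hr} => a G D [/fsubsetP GF *]; apply: GF.
  have fF : f \in F := cF _ bF.
  apply: (ltn_card_fset (f := f)) => [g||]; rewrite !inE.
  - move=> /and3P[+ gF gbF]; rewrite gF gbF /= !andbT.
    by apply: contra => /hr[].
  - by rewrite fF bF (negbTE fq).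
  - by rewrite fF fr.
have accT n : Acc (fun v w => accessible F s w v) (Tail n).
  elim/ltn_ind: n => n IH; constructor=> -[r _|m|//]; first exact: accC.
  exact: IH.
case=> [q|n|q]; [exact: accC | exact: accT |].
by constructor=> -[r _|m _|//]; [exact: accC | exact: accT].
Qed.

(** A box true at the limit is true on the whole tail, whose points see nothing the limit does not
    see. A box false at the limit fails at a successor that all but finitely many tail points also
    see. *)
Lemma eventually_forced_limit (F : {fset formula}) (s : sequent)
    (f : formula) :
  let frc := force (accessible F s) (val s) in
  exists N, forall n, N <= n -> frc (Tail n) f <-> frc (Limit s) f.
Proof.
move=> /=; elim: f => [p||f [N hN] g [M hM]|f _].
- by exists 0.
- by exists 0.
- exists (maxn N M) => n; rewrite geq_max => /andP[Nn Mn] /=.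
  by split=> h /(hN _ Nn) /h /(hM _ Mn).
- case: (classic (force (accessible F s) (val s) (Limit s) (Box f))) => h.
    exists 0 => n _; split=> // _ [r|m|//] acc; first exact: h.
    exact: (h (Tail m) I).
  have [v nv] := not_all_ex_not _ _ h.
  have [sv nf] := imply_to_and _ _ nv.
  case: v {nv} sv nf => [r|m|//] sv nf.
    by exists 0 => n _; split=> // h'; case: nf; apply: h'.
  (* [Tail n] sees the refuting point [Tail m] only when [m < n]. *)
  by exists m.+1 => n mn; split=> // h'; case: nf; apply: h'.
Qed.

(** The limit sees a tail point beyond the threshold for [f], where [f] has the same truth value as
    at the limit. *)
Lemma limit_reflexive (F : {fset formula}) (s : sequent) (f : formula) :
  let frc := force (accessible F s) (val s) in
  frc (Limit s) (Box f) -> frc (Limit s) f.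
Proof.
move=> frc h; have [N hN] := eventually_forced_limit F s f.
by apply/(hN N (leqnn N)); apply: (h (Tail N) I).
Qed.

(** * The truth lemma *)

Section TruthLemma.

Variables (F Gs Ds Gd Dd : {fset formula}).
Hypothesis cF : sub_closed F.
Let s := Gs ⇒S Ds.
Let d := Gd ⇒D Dd.
Hypothesis mx_s : maximal F s.
Hypothesis mx_d : maximal F d.
Hypothesis box_left : forall f : formula, Box f \in Gd -> Box f \in Gs.
Hypothesis box_right : forall f : formula, Box f \in Dd -> Box f \in Ds.

Let good (w : world) : Prop :=
  match w with
  | Canon q => maximal F q /\ seq_arrow q = ArrGL
  | Tail _ => True
  | Limit q => q = s \/ q = d
  end.

Lemma maximal_label (w : world) : good w -> maximal F (label s w).
Proof. by case: w => [q []|n|q [] ->]. Qed.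

Lemma label_box_left (w v : world) (f : formula) :
  good w -> accessible F s w v -> Box f \in antecedent (label s w) ->
  good v /\ f \in antecedent (label s v).
Proof.
have refl g : Box g \in Gs -> g \in Gs by apply: maximal_reflexive mx_s.
case: w v => [q|n|q] [r|m|r] //=.
- by move=> _ [[mr ar hr] _] /hr[].
- by move=> _ [mr ar hr] /hr[].
- by move=> _ _ /refl.
- move=> hq [mr ar hr] bf; split=> //; case: (hr f) => //.
  by case: hq bf => -> //= /box_left.
- move=> hq _ bf; split=> //; apply: refl.
  by case: hq bf => -> //= /box_left.
Qed.

Lemma label_box_right (w : world) (f : formula) :
  good w -> Box f \in succedent (label s w) ->
  exists v, [/\ accessible F s w v, good v & f \in succedent (label s v)].
Proof.
move=> gw bf.
have limit : Box f \in Ds ->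
    exists q, successor F Gs q /\ f \in succedent q.
  case: mx_s => GF DF nGD _ _ bD.
  (* The step from GL to S, read backwards, lets the S-sequent act as an unprovable GL-sequent, so
     its refuted boxes get canonical successors. *)
  have nGL : ~ cut_free_provable (Gs ⇒ Ds) by move/D3_GLtoS.
  have [q [sq _ fq]] := successor_exists cF GF DF nGL bD.
  by exists q.
case: w gw bf => [q|n|q] /=.
- case: q => a G D [mq /= ?] bD; subst a; case: (mq) => GF DF nGD _ _.
  have [q [sq bq fq]] := successor_exists cF GF DF nGD bD.
  (* The box that makes this step strict is [Box f] itself: it is in the antecedent of [q] and, by
     disjointness, not in [G]. *)
  exists (Canon q); split=> //=; last by case: sq.
  split=> //; exists f => //; apply/negP => bG.
  exact: (maximal_disjoint mq bG bD).
- by move=> _ /limit[q [sq fq]]; exists (Canon q); split=> //; case: sq.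
- move=> hq bD; have [|r [sr fr]] := limit.
    by case: hq bD => -> //= /box_right.
  by exists (Canon r); split=> //; case: sr.
Qed.

(** Two implications instead of an equivalence: without cut, a maximal sequent may have a formula of
    [F] on neither side. They are proved together because an implication swaps sides. *)
Lemma truth_lemma (f : formula) (w : world) : good w ->
  (f \in antecedent (label s w) -> force (accessible F s) (val s) w f) /\
  (f \in succedent (label s w) -> ~ force (accessible F s) (val s) w f).
Proof.
elim: f w => [p||f IHf g IHg|f IH] w gw; have := maximal_label gw.
- rewrite /= /val; case: (label s w) => a G D /= mx; split=> // fD fG.
  exact: (maximal_disjoint mx fG fD).
- case: (label s w) => a G D /= mx.
  by split=> [bG|_ //]; apply: (maximal_bot mx bG).
- move: (IHf w gw) (IHg w gw); case: (label s w) => a G D /= [f1 f2] [g1 g2] mx.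
  split=> [fgG hf|fgD h].
    by case: (maximal_imp_left mx cF fgG) => [/f2|/g1].
  by case: (maximal_imp_right mx cF fgD) => /f1 hf /g2; apply; apply: h.
- move=> _; split=> [bG v wv|bD h].
    by have [gv fv] := label_box_left gw wv bG; apply: (IH v gv).1.
  have [v [wv gv fv]] := label_box_right gw bD.
  by apply: (IH v gv).2 fv (h v wv).
Qed.

Lemma maximal_refuted : ~ provable d.
Proof.
have good_d : good (Limit d) by right.
move=> pr.
have [//|f /(truth_lemma f good_d).1 //|f /(truth_lemma f good_d).2 //] := soundness
  (@accessible_trans F s) (accessible_wf s cF) (@limit_reflexive F s)
  (d := Limit d) _ pr (w := Limit d) erefl.
Qed.

End TruthLemma.

Theorem theorem4p8 (Psi Phi : {fset formula}) :
  provable (Psi ⇒D Phi) -> cut_free_provable (Psi ⇒D Phi).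
Proof.
move=> pr; apply: NNPP => ncf.
have [F cF] := sub_closure (Psi `|` Phi); rewrite fsubUset => /andP[PsiF PhiF].
have [Gd [Dd [mx_d sG sD]]] := maximal_extension PsiF PhiF ncf.
have [GF DF nd _ _] := mx_d.
(* The rule from S to D, read backwards on the boxed part of the maximal D-sequent, supplies the
   S-sequent; extending it keeps these boxes on their sides, as the truth lemma requires. *)
have nS : ~ cut_free_provable (boxset (unbox F Gd) ⇒S boxset (unbox F Dd)).
  move=> prS; apply: nd.
  by apply: D3_weakening (D3_StoD prS); apply: boxset_unbox.
have [||Gs [Ds [mx_s sGs sDs]]] := maximal_extension (F := F) _ _ nS.
- exact: fsubset_trans (boxset_unbox F Gd) GF.
- exact: fsubset_trans (boxset_unbox F Dd) DF.
apply: (maximal_refuted cF mx_s mx_d); last exact: D3_weakening pr.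
- by move=> f bf; apply: (fsubsetP sGs); apply: mem_boxset_unbox.
- by move=> f bf; apply: (fsubsetP sDs); apply: mem_boxset_unbox.
Qed.
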